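(* Let $H$ be a hyperpath with $m$ hyperedges $E_1,\ldots,E_m$ (in path order). Suppose that $S_1^{(1)}$ and $S_m^{(1)}$ each have at least two elements and that each non-empty coincident set $S_i^{(2)}$ has at least two elements. Then $$\lambda(H)=\sum_{d=1}^{\Delta(H)}\sum_{i=1}^{\binom{m}{d}}|C_i^{(d)}|,$$ where $|C_i^{(d)}|=|S_i^{(d)}|-1$ if $S_i^{(d)}\neq\emptyset$ and $|C_i^{(d)}|=0$ if $S_i^{(d)}=\emptyset$.
   Context: A hypergraph $H$ is a pair $(V(H),E(H))$ with $V(H)$ a finite set and $E(H)$ a finite family of non-empty subsets of $V(H)$ (hyperedges) whose union is $V(H)$. Standing assumption: all hypergraphs are connected and Sperner (no hyperedge is a subset of another hyperedge). $H$ is a hyperpath if its hyperedges can be ordered as a sequence $E_1,\ldots,E_m$ such that, for $i\neq j$, $E_i\cap E_j\ne\emptyset$ if and only if $|i-j|=1$. The degree of a vertex is the number of hyperedges containing it; $\Delta(H)$ is the maximum degree. For each $d$ let $E_1^{(d)},\ldots,E_{\binom{m}{d}}^{(d)}$ enumerate the $d$-element subsets of $E(H)$, with $E_i^{(1)}=\{E_i\}$; the coincident set $S_i^{(d)}$ is the set of all vertices of degree $d$ that belong to every hyperedge of $E_i^{(d)}$. For a vertex $u$, $N(u)$ is the set of vertices $v\ne u$ such that some hyperedge contains both $u$ and $v$. A set $S\subseteq V(H)$ is locating-dominating if for any two distinct $u,v\in V(H)-S$, $N(u)\cap S\neq N(v)\cap S$, and $N(u)\cap S\ne\emptyset$ for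 every $u\in V(H)-S$. $\lambda(H)$ is the minimum cardinality of a locating-dominating set of $H$. *)

(* Defs.v *)
From mathcomp Require Import all_boot.

Set Implicit Arguments.
Unset Strict Implicit.
Unset Printing Implicit Defensive.

(* The hyperedges form a set rather than a multiset: repeated hyperedges are  *)
(* excluded by the Sperner condition anyway.                                  *)
Record hypergraph := Hypergraph {
  vertex :> finType;
  edges : {set {set vertex}};
  _ : set0 \notin edges;
  _ : cover edges = [set: vertex] }.

Section Hypergraph.
Variable H : hypergraph.
Implicit Types (u v : H) (S : {set H}) (F : {set {set H}}).

Definition neighbors u : {set H} :=
  [set v | (v != u) && [exists A in edges H, (u \in A) && (v \in A)]].

Definition hconnected : Prop :=
  forall u v, connect [rel x y | y \in neighbors x] u v.

Definition sperner : Prop :=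
  forall A B, A \in edges H -> B \in edges H -> A \subset B -> A = B.

Definition degree v : nat := #|[set A in edges H | v \in A]|.

Definition max_degree : nat := \max_(v : H) degree v.

(* Hyperedges are indexed from 0, and the last disjunction is |i - j| = 1.    *)
Definition hyperpath_order m (E : 'I_m -> {set H}) : Prop :=
  [/\ injective E,
      [set E i | i : 'I_m] = edges H
    & forall i j : 'I_m, i != j ->
        (E i :&: E j != set0 <-> j = i.+1 :> nat \/ i = j.+1 :> nat)].

Definition edge_subsets d : {set {set {set H}}} :=
  [set F : {set {set H}} | (F \subset edges H) && (#|F| == d)].

(* The coincident set of F, meant for F in edge_subsets d.                    *)
Definition coincident d F : {set H} :=
  [set v | (degree v == d) && [forall A in F, v \in A]].

Definition coincident_weight d F : nat :=
  if coincident d F != set0 then #|coincident d F| - 1 else 0.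

Definition locating_dominating S : bool :=
  [forall u in ~: S, forall v in ~: S,
     (u != v) ==> (neighbors u :&: S != neighbors v :&: S)]
  && [forall u in ~: S, neighbors u :&: S != set0].

Lemma locating_dominatingT : locating_dominating [set: H].
Proof. by apply/andP; split; apply/forall_inP => u; rewrite setCT inE. Qed.

Definition loc_dom_number : nat :=
  #|[arg min_(S < [set: H] | locating_dominating S) #|S| ]|.

Lemma loc_dom_numberP :
  (exists2 S, locating_dominating S & #|S| = loc_dom_number) /\
  (forall S, locating_dominating S -> loc_dom_number <= #|S|).
Proof.
rewrite /loc_dom_number; case: arg_minnP => [|S ldS minS].
  exact: locating_dominatingT.
by split; first exists S.
Qed.

End Hypergraph.

(* Main.v *)
Require Import Defs.
From mathcomp Require Import all_boot.
From mathcomp Require Import zify.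

Set Implicit Arguments.
Unset Strict Implicit.
Unset Printing Implicit Defensive.

(** Call the set of hyperedges through a vertex its star, and call two vertices
    twins when their stars agree.  A non-empty coincident set is exactly a twin
    class, so the right-hand side of the theorem is the sum, over all twin
    classes, of the size of the class minus one ([coincident_weight_sum]).

    Lower bound, in any hypergraph: twins outside of S have the same neighbors
    in S, so a locating-dominating set misses at most one vertex of each twin
    class ([twin_excess_lower_bound]).

    Upper bound: remove one vertex from each twin class.  What remains has the
    right cardinality, and meets every class of size at least two; it has to be
    shown locating-dominating.  On a hyperpath, for each i some remaining vertex
    lies in E i and in no later hyperedge: take it among the vertices of degree
    one of E 0 if i = 0, and in the intersection of E (i - 1) and E i otherwise;
    the size hypotheses say precisely that these classes have at least two
    elements ([hyperpath_anchor]).  Reversing the path gives a remaining vertex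
    of E i that lies in no earlier hyperedge.  Now let u and v have different
    stars, say u is in E i and v is not.  The hyperedges through v are
    consecutive, hence all after E i or all before E i.  In the first case the
    first kind of anchor is adjacent to u but not to v, in the second case the
    other kind is. *)

(** * Twin classes and coincident sets *)

Section Twins.
Variable H : hypergraph.
Implicit Types (u v w : H) (S : {set H}) (F : {set {set H}}).

Definition star v : {set {set H}} := [set A in edges H | v \in A].

Definition twin_class F : {set H} := [set v | star v == F].

Definition twin_excess : nat := \sum_F (#|twin_class F| - 1).

Lemma mem_neighbors u v :
  reflect (v != u /\ exists2 A, A \in star u & A \in star v)
          (v \in neighbors u).
Proof.
rewrite inE; apply: (iffP andP) => -[nvu].
  case/existsP=> A /andP[eA /andP[uA vA]].
  by split=> //; exists A; rewrite inE eA.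
case=> A; rewrite !inE => /andP[eA uA] /andP[_ vA]; split=> //.
by apply/existsP; exists A; rewrite eA uA.
Qed.

Lemma degree_gt0 v : 0 < degree v.
Proof.
have : v \in cover (edges H) by case: H v => V D D0 /= -> v; rewrite inE.
case/bigcupP=> A eA vA.
by rewrite /degree (cardD1 A) inE eA vA.
Qed.

(** A vertex of degree d lying in all d members of F has no further hyperedge,
    so its star is F itself. *)
Lemma coincident_twin_class d F :
  F \in edge_subsets H d -> coincident d F = twin_class F.
Proof.
rewrite inE => /andP[sFE /eqP cF]; apply/setP=> v; rewrite !inE.
apply/andP/eqP => [[/eqP dv /forall_inP Fv]|svF].
  apply/esym/eqP; rewrite eqEcard cF -dv leqnn andbT.
  by apply/subsetP=> A FA; rewrite inE (subsetP sFE) ?Fv.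
rewrite -cF -svF /degree eqxx; split=> //.
by apply/forall_inP=> A; rewrite inE => /andP[].
Qed.

Lemma coincident_weight_sum :
  \sum_(1 <= d < (max_degree H).+1)
      \sum_(F in edge_subsets H d) coincident_weight d F = twin_excess.
Proof.
(* Truncated subtraction gives 0 for an empty class, as the weight does. *)
transitivity (\sum_(1 <= d < (max_degree H).+1)
                \sum_(F in edge_subsets H d) (#|twin_class F| - 1)).
  apply: eq_bigr => d _; apply: eq_bigr => F FEd.
  rewrite /coincident_weight (coincident_twin_class FEd).
  by case: eqP => // ->; rewrite cards0.
under eq_bigr do rewrite big_mkcond.
rewrite exchange_big; apply: eq_bigr => F _ /=.
have [-> | [v]] := set_0Vmem (twin_class F).
  by rewrite cards0 big1 // => d _; rewrite if_same.
rewrite inE => /eqP svF.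
have sFE : F \subset edges H.
  by rewrite -svF; apply/subsetP=> A; rewrite inE => /andP[].
have dF : #|F| \in index_iota 1 (max_degree H).+1.
  rewrite mem_index_iota -svF degree_gt0 ltnS.
  exact: (@leq_bigmax _ (fun v => degree v)).
rewrite (bigD1_seq #|F|) ?iota_uniq //= inE sFE eqxx big1 ?addn0 // => d.
by rewrite inE eq_sym => /negPf->; rewrite andbF.
Qed.

Lemma card_twin_partition S : #|S| = \sum_F #|S :&: twin_class F|.
Proof.
rewrite -sum1_card (partition_big star predT) //=.
by apply: eq_bigr => F _; rewrite -sum1_card; apply: eq_bigl => v; rewrite !inE.
Qed.

Lemma twin_excess_lower_bound S : locating_dominating S -> twin_excess <= #|S|.
Proof.
case/andP=> /forall_inP locS _.
rewrite (card_twin_partition S); apply: leq_sum => F _.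
suff: #|twin_class F :\: S| <= 1.
  by rewrite leq_subLR -(cardsID S (twin_class F)) setIC addnC leq_add2r.
apply/card_le1_eqP => u v; rewrite !inE => /andP[uS /eqP su] /andP[vS /eqP sv].
apply/eqP; apply: contraT => nuv.
have uS' : u \in ~: S by rewrite inE.
have /forall_inP/(_ v) := locS _ uS'.
rewrite inE eq_sym nuv => /(_ vS)/eqP[]; apply/setP=> w.
rewrite !in_setI; case wS: (w \in S); rewrite ?andbF // !andbT.
have nw x : x \notin S -> w != x by apply: contraNneq => <-; rewrite wS.
by apply/mem_neighbors/mem_neighbors; rewrite su sv !nw //; case.
Qed.

(** * Removing one vertex from each twin class *)

(** The removed vertex of a class is the one that [pick] selects; the selection
    depends on the star only, hence is the same for all twins. *)
Definition twin_reduced : {set H} :=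
  [set v | [pick u in twin_class (star v)] != Some v].

Lemma card_twin_reduced_class F :
  #|twin_reduced :&: twin_class F| = #|twin_class F| - 1.
Proof.
have [F0 | [v vF]] := set_0Vmem (twin_class F).
  by rewrite F0 setI0 cards0.
have [r pickF rF] : exists2 r, [pick u in twin_class F] = Some r
                               & r \in twin_class F.
  by case: pickP => [r rF | /(_ v)]; [exists r | rewrite vF].
rewrite (cardsD1 r (twin_class F)) rF addKn; congr #|pred_of_set _|.
apply/setP=> w; rewrite in_setI in_setD1 [w \in twin_reduced]inE.
case wF: (w \in twin_class F); rewrite ?andbF // !andbT.
have -> : star w = F by move: wF; rewrite inE => /eqP.
by rewrite pickF eq_sym.
Qed.

Lemma card_twin_reduced : #|twin_reduced| = twin_excess.
Proof.
rewrite card_twin_partition; apply: eq_bigr => F _.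
exact: card_twin_reduced_class.
Qed.

Lemma twin_reduced_meets F :
  1 < #|twin_class F| -> exists2 w, w \in twin_reduced & star w = F.
Proof.
rewrite -subn_gt0 -card_twin_reduced_class => /card_gt0P[w].
by rewrite in_setI => /andP[wS]; rewrite inE => /eqP; exists w.
Qed.

Lemma star_inj_removed u v :
  u \notin twin_reduced -> v \notin twin_reduced -> star u = star v -> u = v.
Proof. by rewrite !inE !negbK => /eqP + /eqP + suv; rewrite suv => -> []. Qed.

End Twins.

(** * Hyperpaths *)

Section Hyperpath.
Variables (H : hypergraph) (m : nat).
Implicit Types (E : 'I_m -> {set H}) (i j k : 'I_m) (u v w : H).

Lemma hyperpath_edge E i : hyperpath_order E -> E i \in edges H.
Proof. by case=> _ <- _; apply: imset_f. Qed.

Lemma hyperpath_rev E :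
  hyperpath_order E -> hyperpath_order (fun i => E (rev_ord i)).
Proof.
case=> injE imE adjE; split.
- by move=> i j /injE/rev_ord_inj.
- rewrite -imE; apply/setP=> A; apply/imsetP/imsetP=> -[i _ ->].
    by exists (rev_ord i).
  by exists (rev_ord i); rewrite ?rev_ordK.
move=> i j nij; have /adjE -> : rev_ord i != rev_ord j.
  by rewrite (inj_eq rev_ord_inj).
have [? ?] := (ltn_ord i, ltn_ord j); rewrite /=; lia.
Qed.

Lemma hyperpath_common E i j v :
  hyperpath_order E -> v \in E i -> v \in E j -> j <= i.+1.
Proof.
case=> _ _ adjE vi vj; have [-> // | /adjE[adj _]] := eqVneq i j.
have /adj : E i :&: E j != set0 by apply/set0Pn; exists v; rewrite inE vi.
lia.
Qed.

Lemma hyperpath_star E v A :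
  hyperpath_order E -> reflect (exists2 i, A = E i & v \in E i) (A \in star v).
Proof.
move=> pathE; rewrite inE; apply: (iffP andP) => [[]|[i -> vi]].
  by case: pathE => _ <- _ /imsetP[i _ ->]; exists i.
by rewrite hyperpath_edge.
Qed.

(** The anchor has the star of a vertex common to E (i - 1) and E i; no third
    hyperedge of the path meets both, so that this star has two elements.  If
    i = 0, the star is that of a vertex of degree one. *)
Lemma hyperpath_anchor E (pathE : hyperpath_order E)
    (end_ge2 : forall i, i = 0 :> nat -> 1 < #|twin_class [set E i]|)
    (pair_ge2 : forall v, degree v = 2 -> 1 < #|twin_class (star v)|) i :
  exists w, [/\ w \in twin_reduced H, w \in E i
              & forall j, i < j -> w \notin E j].
Proof.
have [injE _ adjE] := pathE.
have [i0 | i_gt0] := posnP i.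
  have [w wS sw] := twin_reduced_meets (end_ge2 i i0).
  have wE j : (w \in E j) = (j == i).
    transitivity (E j \in star w); first by rewrite inE hyperpath_edge.
    by rewrite sw inE (inj_eq injE).
  exists w; split; rewrite ?wE // => j lt_ij.
  by rewrite wE; apply: contraTneq lt_ij => ->; rewrite ltnn.
have ltk : i.-1 < m by apply: leq_ltn_trans (leq_pred i) (ltn_ord i).
pose k := Ordinal ltk.
have nki : k != i by rewrite -val_eqE /=; lia.
have [v] : exists v, v \in E k :&: E i.
  by apply/set0Pn/adjE => //; left; rewrite /=; lia.
rewrite inE => /andP[vk vi].
have sv : star v = [set E k; E i].
  apply/setP=> A; rewrite in_set2.
  apply/(hyperpath_star _ _ pathE)/orP => [[j -> vj]|].
    have le_jk := hyperpath_common pathE vk vj.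
    have le_ij := hyperpath_common pathE vj vi.
    by rewrite !(inj_eq injE) -!val_eqE /= in le_jk le_ij *; lia.
  by case=> /eqP->; [exists k | exists i].
have [|w wS sw] := twin_reduced_meets (pair_ge2 v _).
  by change (#|star v| = 2); rewrite sv cards2 (inj_eq injE) nki.
have wE j : (w \in E j) = (j == k) || (j == i).
  transitivity (E j \in star w); first by rewrite inE hyperpath_edge.
  by rewrite sw sv in_set2 !(inj_eq injE).
exists w; split; rewrite ?wE ?eqxx ?orbT // => j lt_ij.
by rewrite wE -!val_eqE /=; lia.
Qed.

Lemma hyperpath_locating_dominating E (S : {set H})
    (pathE : hyperpath_order E)
    (starS : forall u v, u \notin S -> v \notin S -> star u = star v -> u = v)
    (anchor_before : forall i, exists w,
       [/\ w \in S, w \in E i & forall j, i < j -> w \notin E j])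
    (anchor_after : forall i, exists w,
       [/\ w \in S, w \in E i & forall j, j < i -> w \notin E j]) :
  locating_dominating S.
Proof.
have adjacent u w i : u \notin S -> w \in S -> u \in E i -> w \in E i ->
    w \in neighbors u.
  move=> uS wS ui wi; apply/mem_neighbors; split.
    by apply: contraNneq uS => <-.
  by exists (E i); apply/(hyperpath_star _ _ pathE); exists i.
have separate u v i : u \notin S -> v \notin S -> u \in E i -> v \notin E i ->
    neighbors u :&: S != neighbors v :&: S.
  move=> uS vS ui vi.
  suff [w [wS wi wv]] : exists w, [/\ w \in S, w \in E i
      & forall j, v \in E j -> w \notin E j].
    apply/eqP=> /setP/(_ w); rewrite !in_setI wS !andbT (adjacent u w i) //.
    case/esym/mem_neighbors=> _ [A /(hyperpath_star _ _ pathE)[j -> vj]].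
    by rewrite inE (negPf (wv j vj)) andbF.
  (* The hyperedges through v are consecutive and avoid E i. *)
  have [/existsP[k /andP[vk lt_ki]] | no_before] :=
      boolP [exists k, (v \in E k) && (k < i)].
    have [w [wS wi wj]] := anchor_after i; exists w; split=> // j vj.
    apply: wj; rewrite ltn_neqAle (leq_trans (hyperpath_common pathE vk vj)) //.
    by rewrite andbT; apply: contraNneq vi => /val_inj <-.
  have [w [wS wi wj]] := anchor_before i; exists w; split=> // j vj.
  apply: wj; rewrite ltn_neqAle leqNgt; apply/andP; split.
    by apply: contraNneq vi => /val_inj ->.
  by move/existsPn/(_ j): no_before; rewrite vj.
apply/andP; split; last first.
  apply/forall_inP=> u; rewrite inE => uS.
  have /card_gt0P[A /(hyperpath_star _ _ pathE)[i _ ui]] := degree_gt0 u.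
  have [w [wS wi _]] := anchor_before i.
  by apply/set0Pn; exists w; rewrite inE wS andbT (adjacent u w i).
apply/forall_inP=> u; rewrite inE => uS; apply/forall_inP=> v.
rewrite inE => vS; apply/implyP=> nuv.
have [/existsP[i] | same] := boolP [exists i, (u \in E i) != (v \in E i)].
  case: (boolP (u \in E i)) => ui; case: (boolP (v \in E i)) => vi // _.
    exact: separate ui vi.
  by rewrite eq_sym; apply: separate vi ui.
case/eqP: nuv; apply: starS => //; apply/setP=> A.
by apply/(hyperpath_star _ _ pathE)/(hyperpath_star _ _ pathE) => -[i -> vi];
  exists i => //; move/existsPn/(_ i): same; rewrite vi negbK => /eqP.
Qed.

End Hyperpath.

Theorem theorem3p5 (H : hypergraph) (H_conn : hconnected H)
    (H_sperner : sperner H)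
    (m : nat) (E : 'I_m -> {set H}) (E_path : hyperpath_order E)
    (S1_ge2 : forall i : 'I_m, i = 0 :> nat -> 2 <= #|coincident 1 [set E i]|)
    (Sm_ge2 : forall i : 'I_m, i.+1 = m -> 2 <= #|coincident 1 [set E i]|)
    (S2_ge2 : forall F : {set {set H}}, F \in edge_subsets H 2 ->
       coincident 2 F <> set0 -> 2 <= #|coincident 2 F|) :
  loc_dom_number H =
    \sum_(1 <= d < (max_degree H).+1)
      \sum_(F in edge_subsets H d) coincident_weight d F.
Proof.
have edge1 i : [set E i] \in edge_subsets H 1.
  by rewrite inE sub1set hyperpath_edge // cards1.
have pair_ge2 (v : H) : degree v = 2 -> 1 < #|twin_class (star v)|.
  move=> dv; have F2 : star v \in edge_subsets H 2.
    rewrite inE; apply/andP; split; last exact/eqP.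
    by apply/subsetP=> A; rewrite inE => /andP[].
  rewrite -(coincident_twin_class F2); apply: S2_ge2 => //.
  by move/setP/(_ v); rewrite (coincident_twin_class F2) !inE eqxx.
have ld : locating_dominating (twin_reduced H).
  apply: (hyperpath_locating_dominating E_path).
  - exact: star_inj_removed.
  - apply: hyperpath_anchor => // i i0.
    by rewrite -(coincident_twin_class (edge1 i)) S1_ge2.
  move=> i.
  have [|w] :=
    hyperpath_anchor (hyperpath_rev E_path) _ pair_ge2 (rev_ord i).
    move=> j j0; rewrite -(coincident_twin_class (edge1 _)) Sm_ge2 //=.
    by have := ltn_ord j; lia.
  rewrite rev_ordK => -[wS wi wj]; exists w; split=> // j lt_ji.
  rewrite -[j]rev_ordK; apply: wj => /=.
  by have := ltn_ord i; lia.
rewrite coincident_weight_sum.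
have [[S ldS <-] minS] := loc_dom_numberP H.
apply/eqP; rewrite eqn_leq (twin_excess_lower_bound ldS) andbT.
by rewrite -card_twin_reduced minS.
Qed.
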